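(* Let $a,b,h,a'',b''$ be smooth functions of $(u,v)$ on an open set $D\subset\mathbb{R}^2$, with $h$ nowhere zero, satisfying the integrability conditions $$ah=h_u,\quad a_v=ba''+h,\quad b_v+bb''=0,\quad h_v=b''h,\quad a''_u+aa''=0,\quad h=b''_u+a''b.$$ Consider, for one unknown function $\theta=\theta(u,v)$, the PDE system $$\theta_{uu}=a\theta_u+b\theta_v,\qquad \theta_{uv}=h\theta,\qquad \theta_{vv}=a''\theta_u+b''\theta_v.$$ Let $\bar G$ be the full symmetry group of this system and let $\bar G_2$ be the subgroup of $\bar G$ which acts on the space of the independent variables $u,v$ (that is, whose infinitesimal generators have the form $\zeta(u,v)\frac{\partial}{\partial u}+\eta(u,v)\frac{\partial}{\partial v}$). Then the general vector field of the algebra of the infinitesimal symmetries associated to $\bar G_2$ is $$\bar Z=\zeta(u)\frac{\partial}{\partial u}+\eta(v)\frac{\partial}{\partial v},$$ where $\zeta=\zeta(u)$ and $\eta=\eta(v)$ satisfy $$\begin{aligned}&\zeta a_u+\eta a_v+a\zeta_u+\zeta_{uu}=0,\\ &\zeta b_u+\eta b_v-b\eta_v+2b\zeta_u=0,\\ &\zeta h_u+\eta h_v+h(\zeta_u+\eta_v)=0,\\ &\zeta a''_u+\eta a''_v-a''\zeta_u+2a''\eta_v=0,\\ &\zeta b''_u+\eta b''_v+b''\eta_v+\eta_{vv}=0.\end{aligned}$$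
   Context: The functions $a,b,h,a'',b''$ are five independent names (the double prime is not a derivative); subscripts $u,v$ denote partial derivatives. Symmetry groups: a symmetry group of a PDE system $\Delta_\nu(x,u^{(n)})=0$, $\nu=1,\dots,l$, in independent variables $x=(x^1,\dots,x^p)$ and dependent variables $u=(u^1,\dots,u^q)$ ($u^{(n)}$ denotes all derivatives of orders $0$ to $n$) is a local group of transformations acting on an open subset $M$ of the space of independent and dependent variables that transforms solutions into solutions. Its Lie algebra of infinitesimal generators (infinitesimal symmetries) is determined by the infinitesimal invariance condition: a vector field $X=\sum_i\zeta^i(x,u)\frac{\partial}{\partial x^i}+\sum_\alpha\phi_\alpha(x,u)\frac{\partial}{\partial u^\alpha}$ is an infinitesimal symmetry if $\mathrm{pr}^{(n)}X[\Delta_\nu(x,u^{(n)})]=0$ for all $\nu$ whenever $\Delta(x,u^{(n)})=0$, where $\mathrm{pr}^{(n)}X=X+\sum_\alpha\sum_J\phi_\alpha^J\frac{\partial}{\partial u^\alpha_J}$, the sum being over multi-indices of order $1\le |J|\le n$, and $\phi^J_\alpha=D_J\big(\phi_\alpha-\sum_i\zeta^iu^\alpha_i\big)+\sum_i\zeta^iu^\alpha_{J,i}$ with $D_J$ the total derivative. The full symmetry group is the one generated by all infinitesimal symmetries. *)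

(* Defs.v *)
(* MathComp-Analysis: R is an arbitrary realType. *)
From HB Require Import structures.
From mathcomp Require Import all_boot all_order all_algebra.
From mathcomp Require Import all_classical all_reals all_analysis.

Set Implicit Arguments.
Unset Strict Implicit.
Unset Printing Implicit Defensive.

Import Order.TTheory GRing.Theory Num.Theory.
Import numFieldNormedType.Exports.

Local Open Scope classical_set_scope.
Local Open Scope ring_scope.

(* C^k on the open set U: all iterated directional derivatives of order at most
   k exist and are continuous on U. *)
Fixpoint Ck_on (R : realType) (V : normedModType R) (k : nat) (U : set V)
    (f : V -> R) : Prop :=
  (forall x, U x -> {for x, continuous f}) /\
  match k with
  | 0%N => True
  | k'.+1 => forall v : V,
      (forall x, U x -> derivable f x v) /\ Ck_on k' U ('D_v f)
  end.

Definition smooth_on (R : realType) (V : normedModType R) (U : set V)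
    (f : V -> R) : Prop :=
  forall k, Ck_on k U f.

Definition pd_u (R : realType) (f : R * R -> R) : R * R -> R :=
  'D_((1, 0) : R * R) f.

Definition pd_v (R : realType) (f : R * R -> R) : R * R -> R :=
  'D_((0, 1) : R * R) f.

(* A jet of a function theta(u,v) over a point (u,v): w i j stands for the
   coordinate d^(i+j) theta / du^i dv^j; in particular w 0 0 is theta. *)
Definition jet (R : realType) := nat -> nat -> R.

Definition diff_fun (R : realType) := R * R -> jet R -> R.

Definition jet_upd (R : realType) (w : jet R) (i j : nat) (t : R) : jet R :=
  fun k l => if (k == i) && (l == j) then t else w k l.

Definition dF_theta (R : realType) (i j : nat) (F : diff_fun R) : diff_fun R :=
  fun p w => derive1 (fun t : R => F p (jet_upd w i j t)) (w i j).

(* Total derivatives of differential functions of order at most n; the sum over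
   the jet coordinates may then be cut at order n. *)
Definition total_u (R : realType) (n : nat) (F : diff_fun R) : diff_fun R :=
  fun p w => pd_u (F^~ w) p +
    \sum_(i < n.+1) \sum_(j < n.+1 | (i + j <= n)%N)
      w i.+1 j * dF_theta i j F p w.

Definition total_v (R : realType) (n : nat) (F : diff_fun R) : diff_fun R :=
  fun p w => pd_v (F^~ w) p +
    \sum_(i < n.+1) \sum_(j < n.+1 | (i + j <= n)%N)
      w i j.+1 * dF_theta i j F p w.

Definition total_J (R : realType) (n i j : nat) (F : diff_fun R) : diff_fun R :=
  iter i (total_u n) (iter j (total_v n) F).

(* zeta d/du + eta d/dv + phi d/dtheta; a point of the space of independent and
   dependent variables is written ((u, v), theta). *)
Record vfield (R : realType) := VField {
  vzeta : R * R * R -> R;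
  veta : R * R * R -> R;
  vphi : R * R * R -> R }.

Definition characteristic (R : realType) (X : vfield R) : diff_fun R :=
  fun p w => let m := (p, w 0%N 0%N) in
    vphi X m - (vzeta X m * w 1%N 0%N + veta X m * w 0%N 1%N).

(* phi^J for J = (i, j); for i + j <= n every function to which a total
   derivative is applied here has order at most n. *)
Definition phiJ (R : realType) (n : nat) (X : vfield R) (i j : nat) :
    diff_fun R :=
  fun p w => let m := (p, w 0%N 0%N) in
    total_J n i j (characteristic X) p w
    + (vzeta X m * w i.+1 j + veta X m * w i j.+1).

Definition prolong (R : realType) (n : nat) (X : vfield R) (F : diff_fun R) :
    diff_fun R :=
  fun p w => let m := (p, w 0%N 0%N) in
    vzeta X m * pd_u (F^~ w) p + veta X m * pd_v (F^~ w) p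
    + vphi X m * dF_theta 0 0 F p w
    + \sum_(i < n.+1) \sum_(j < n.+1 | (1 <= i + j <= n)%N)
        phiJ n X i j p w * dF_theta i j F p w.

Definition symmetry_algebra (R : realType) (n l : nat) (D : set (R * R))
    (Delta : 'I_l -> diff_fun R) : set (vfield R) :=
  [set X | [/\ smooth_on (D `*` [set: R]) (vzeta X),
               smooth_on (D `*` [set: R]) (veta X),
               smooth_on (D `*` [set: R]) (vphi X) &
    forall (nu : 'I_l) (p : R * R) (w : jet R), D p ->
      (forall mu, Delta mu p w = 0) -> prolong n X (Delta nu) p w = 0]].

Definition on_independent_variables (R : realType) (D : set (R * R)) :
    set (vfield R) :=
  [set X | exists zeta eta : R * R -> R, forall p th, D p ->
    [/\ vzeta X (p, th) = zeta p, veta X (p, th) = eta p &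
        vphi X (p, th) = 0]].

(* In what follows a2 and b2 are a'' and b''. *)
Definition theta_system (R : realType) (a b h a2 b2 : R * R -> R) (k : 'I_3) :
    diff_fun R :=
  fun p w => match val k with
    | 0%N => w 2%N 0%N - (a p * w 1%N 0%N + b p * w 0%N 1%N)
    | 1%N => w 1%N 1%N - h p * w 0%N 0%N
    | _ => w 0%N 2%N - (a2 p * w 1%N 0%N + b2 p * w 0%N 1%N)
    end.

Definition integrability (R : realType) (D : set (R * R))
    (a b h a2 b2 : R * R -> R) : Prop :=
  forall p, D p ->
    [/\ a p * h p = pd_u h p,
        pd_v a p = b p * a2 p + h p &
        pd_v b p + b p * b2 p = 0] /\
    [/\ pd_v h p = b2 p * h p,
        pd_u a2 p + a p * a2 p = 0 &
        h p = pd_u b2 p + a2 p * b p].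

(* The Lie algebra of the subgroup of the full symmetry group of the system
   that acts on the space of the independent variables. *)
Definition G2_algebra (R : realType) (D : set (R * R))
    (a b h a2 b2 : R * R -> R) : set (vfield R) :=
  symmetry_algebra 2 D (theta_system a b h a2 b2)
    `&` on_independent_variables D.

Definition determining_equations (R : realType) (a b h a2 b2 : R * R -> R)
    (zeta eta : R -> R) (p : R * R) : Prop :=
  let z := zeta p.1 in let z1 := derive1 zeta p.1 in
  let z2 := derive1n 2 zeta p.1 in
  let e := eta p.2 in let e1 := derive1 eta p.2 in
  let e2 := derive1n 2 eta p.2 in
  [/\ z * pd_u a p + e * pd_v a p + a p * z1 + z2 = 0,
      z * pd_u b p + e * pd_v b p - b p * e1 + 2 * b p * z1 = 0,
      z * pd_u h p + e * pd_v h p + h p * (z1 + e1) = 0,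
      z * pd_u a2 p + e * pd_v a2 p - a2 p * z1 + 2 * a2 p * e1 = 0 &
      z * pd_u b2 p + e * pd_v b2 p + b2 p * e1 + e2 = 0].

(* X = zeta(u) d/du + eta(v) d/dv over U, with one-variable functions zeta and
   eta satisfying the determining equations. *)
Definition general_form (R : realType) (U : set (R * R))
    (a b h a2 b2 : R * R -> R) (X : vfield R) : Prop :=
  exists zeta eta : R -> R,
    [/\ smooth_on (fst @` U) zeta,
        smooth_on (snd @` U) eta,
        forall p th, U p -> [/\ vzeta X (p, th) = zeta p.1,
          veta X (p, th) = eta p.2 & vphi X (p, th) = 0] &
        forall p, U p -> determining_equations a b h a2 b2 zeta eta p].

(* Main.v *)
(* Along a vector field zeta d/du + eta d/dv the prolongation of each equation is
   linear in the jet coordinates, and on solutions theta, theta_u and theta_v may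
   be prescribed freely. The coefficients of theta in the first and third
   conditions are -2 h eta_u and -2 h zeta_v, so zeta_v = eta_u = 0 because h has
   no zero; the remaining coefficients are the five determining equations. *)
Require Import Defs.
From HB Require Import structures.
From mathcomp Require Import all_boot all_order all_algebra.
From mathcomp Require Import all_classical all_reals all_analysis.
From mathcomp Require Import ring lra.

Set Implicit Arguments.
Unset Strict Implicit.
Unset Printing Implicit Defensive.

Import Order.TTheory GRing.Theory Num.Theory.
Import numFieldNormedType.Exports.

Local Open Scope classical_set_scope.
Local Open Scope ring_scope.

(** * Locality of derivatives and smoothness; affine changes of variables *)

Lemma eq_on_open_derive (R : realType) (V W : normedModType R) (U : set V)
    (f g : V -> W) : open U -> (forall x, U x -> f x = g x) ->
  forall x v, U x -> 'D_v f x = 'D_v g x.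
Proof.
move=> oU fg x v Ux; apply: near_eq_derive.
by apply: filterS (open_nbhs_nbhs (conj oU Ux)) => y; exact: fg.
Qed.

(** [Ck_on] only tests [f] and its iterated derivatives at the points of the set, so it can be
    checked one point at a time, each inside its own [U']. *)
Lemma Ck_on_local (R : realType) (V : normedModType R) k (U : set V)
    (f : V -> R) :
  (forall x, U x -> exists2 U', U' x & Ck_on k U' f) -> Ck_on k U f.
Proof.
elim: k f => [|k IHk] f locf.
  by split => // x Ux; have [U' U'x [cf _]] := locf x Ux; exact: cf.
split=> [x Ux|v]; first by have [U' U'x [cf _]] := locf x Ux; exact: cf.
split=> [x Ux|].
  by have [U' U'x [_ /(_ v)[df _]]] := locf x Ux; exact: df.
apply: IHk => x Ux; have [U' U'x [_ /(_ v)[_ Ckf]]] := locf x Ux.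
by exists U'.
Qed.

Lemma smooth_on_derive (R : realType) (V : normedModType R) (U : set V)
    (f : V -> R) v : smooth_on U f -> smooth_on U ('D_v f).
Proof. by move=> sf k; have [_ /(_ v)[]] := sf k.+1. Qed.

Lemma smooth_on_derivable (R : realType) (V : normedModType R) (U : set V)
    (f : V -> R) x v : smooth_on U f -> U x -> derivable f x v.
Proof. by move=> sf Ux; have [_ /(_ v)[df _]] := sf 1%N; exact: df. Qed.

(* The maps p |-> (p, theta), u |-> (u, v), (u, v) |-> u, ... between the spaces
   on which zeta and eta live are all of this form, with linear part L. *)
Section affine_change.
Context {R : realType} {V W : normedModType R}.
Variables (A : V -> W) (L : V -> W).
Hypothesis cA : continuous A.
Hypothesis AL : forall x v t, A (t *: v + x) = t *: L v + A x.
Variables (U : set V) (oU : open U).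

(** The difference quotient of [g \o A] at [x] along [v] is literally that of [g] at [A x] along
    [L v], so no chain rule is involved. *)
Lemma derive_affine (f : V -> R) (g : W -> R) x v :
  (forall y, U y -> f y = g (A y)) -> U x -> 'D_v f x = 'D_(L v) g (A x).
Proof.
move=> fg Ux; rewrite (eq_on_open_derive oU fg)//.
rewrite /derive (_ : (fun _ => _) = fun t : R =>
  t^-1 *: ((g \o shift (A x)) (t *: L v) - g (A x)))//.
by apply/funext => t /=; rewrite AL.
Qed.

Lemma derivable_affine (f : V -> R) (g : W -> R) x v :
  (forall y, U y -> f y = g (A y)) -> U x ->
  derivable g (A x) (L v) -> derivable f x v.
Proof.
move=> fg Ux dg.
apply: (@near_eq_derivable _ _ _ (g \o A)).
  by apply: filterS (open_nbhs_nbhs (conj oU Ux)) => y Uy; exact/esym/fg.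
rewrite /derivable (_ : (fun _ => _) = fun t : R =>
  t^-1 *: ((g \o shift (A x)) (t *: L v) - g (A x)))//.
by apply/funext => t /=; rewrite AL.
Qed.

(** Induction on [k]: by [derive_affine], ['D_v f] is again a composite with [A] on [U], now of
    ['D_(L v) g]. *)
Lemma Ck_on_affine k (f : V -> R) (g : W -> R) (U' : set W) :
  (forall x, U x -> U' (A x)) -> (forall y, U y -> f y = g (A y)) ->
  Ck_on k U' g -> Ck_on k U f.
Proof.
move=> UU'; have cf (f' : V -> R) (g' : W -> R) : (forall y, U y -> f' y = g' (A y)) ->
    (forall y, U' y -> {for y, continuous g'}) ->
    forall x, U x -> {for x, continuous f'}.
  move=> fg cg x Ux; suff : f' @ x --> f' x by [].
  rewrite (fg _ Ux); apply: (@cvg_trans _ ((g' \o A) @ x)).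
    apply: near_eq_cvg.
    by apply: filterS (open_nbhs_nbhs (conj oU Ux)) => y Uy; exact/esym/fg.
  have cgx : g' @ A x --> g' (A x) by exact: cg (UU' _ Ux).
  by have := cvg_comp A g' (@cA x) cgx.
elim: k f g => [|k IHk] f g fg [cg Cg]; split => //; try exact: cf cg.
move=> v; have [dg Ckg] := Cg (L v); split=> [x Ux|].
  by apply: derivable_affine (dg _ (UU' _ Ux)).
by apply: IHk Ckg => y Uy; exact: derive_affine.
Qed.

End affine_change.

(** * Functions with zero derivative on an interval *)

Section axis_constant.
Context {R : realType}.

Lemma zero_derive_interval_cst (f : R -> R) (I : set R) :
  is_interval I -> (forall x, I x -> is_derive x 1 f 0) ->
  forall x y, I x -> I y -> f x = f y.
Proof.
move=> itvI df; suff H x y : I x -> I y -> x <= y -> f x = f y.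
  move=> x y Ix Iy; have [xy|yx] := leP x y; first exact: H.
  by apply/esym/H => //; exact: ltW.
move=> Ix Iy xy.
have Iz z : x <= z <= y -> I z by apply: itvI.
have [||c _] := @MVT_segment R f (cst 0) x y xy.
- move=> z; rewrite in_itv/= => /andP[/ltW xz /ltW zy].
  by apply/df/Iz; rewrite xz zy.
- apply: derivable_within_continuous => z; rewrite in_itv/= => zxy.
  by have [] := df z (Iz z zxy).
by rewrite mul0r => /eqP; rewrite subr_eq0 => /eqP.
Qed.

End axis_constant.

(** * Total derivatives and prolongations of functions linear in the jet *)

Section linear_differential_functions.
Context {R : realType}.
Implicit Types (s : seq (nat * nat * (R * R -> R))) (k : R) (p : R * R)
  (w : jet R) (D : set (R * R)) (F : diff_fun R).

(* A differential function that is linear in the jet is encoded by the list of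
   its terms: (i, j, c) stands for c(u, v) times the coordinate w i j. *)
Definition lin s p w : R := \sum_(m <- s) m.2 p * w m.1.1 m.1.2.

(** A sum, because one pair (i, j) may occur several times in the list, as it does after two total
    derivatives. *)
Definition coef s i j p : R := \sum_(m <- s | m.1 == (i, j)) m.2 p.

(** The factor [k] is -1 for the characteristic -(z theta_u + e theta_v), whose terms then carry [z]
    and [e] themselves, and 1 for the equations of the system. *)
Definition lin_on D k s F := forall p w, D p -> F p w = k * lin s p w.

Definition order_le (n : nat) s := all (fun m => (m.1.1 + m.1.2 <= n)%N) s.

Definition smooth_coefs D s := List.Forall (fun m => smooth_on D m.2) s.

Lemma derive1_affine (c d x : R) : derive1 (fun t => t * c + d) x = c.
Proof.
rewrite derive1E.
have -> : (fun t => t * c + d) = c *: (@id R) + cst d.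
  by apply/funext => t; rewrite /= mulrC.
by rewrite deriveD// deriveZ// derive_cst derive_id addr0 -[RHS]mulr1.
Qed.

(** As a function of the single coordinate [w i j], [F] is affine: the terms indexed by (i, j) give
    the slope, all others the constant. *)
Lemma dF_theta_lin D k s F i j p w : lin_on D k s F -> D p ->
  dF_theta i j F p w = k * coef s i j p.
Proof.
move=> FE Dp; rewrite /dF_theta.
suff -> : (fun t => F p (jet_upd w i j t)) = fun t => t * (k * coef s i j p) +
    k * \sum_(m <- s | m.1 != (i, j)) m.2 p * w m.1.1 m.1.2.
  exact: derive1_affine.
apply/funext => t; rewrite FE// /lin.
rewrite (bigID (fun m => m.1 == (i, j)))/= mulrDr; congr +%R.
  rewrite /coef [RHS]mulrC -mulrA mulr_suml; congr *%R.
  apply: eq_bigr => m /eqP ->.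
  by rewrite /jet_upd !eqxx.
congr *%R; apply: eq_bigr => -[[i' j'] c]/= /negPf; rewrite xpair_eqE /jet_upd/=.
by move=> ->.
Qed.

(** Exchanges a sum over jet coordinates for a sum over the terms of the list. The bound on [P] puts
    every selected pair within the range of the two indices. *)
Lemma sum_coef n (P : nat -> nat -> bool) (G : nat -> nat -> R) s p :
  (forall i j, P i j -> (i + j <= n)%N) ->
  \sum_(i < n.+1) \sum_(j < n.+1 | P i j) G i j * coef s i j p =
  \sum_(m <- s | P m.1.1 m.1.2) G m.1.1 m.1.2 * m.2 p.
Proof.
move=> Pn; rewrite pair_big_dep/=.
elim: s => [|[[i j] c] s IHs].
  by rewrite big_nil big1// => ij _; rewrite /coef big_nil mulr0.
rewrite big_cons/= -IHs.
have coefE (ij : 'I_n.+1 * 'I_n.+1) : coef ((i, j, c) :: s) ij.1 ij.2 p =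
    (if (i, j) == (ij.1 : nat, ij.2 : nat) then c p else 0)
    + coef s ij.1 ij.2 p.
  by rewrite /coef big_cons/=; case: ifP => //; rewrite add0r.
under eq_bigr do rewrite coefE mulrDr.
rewrite big_split/=; case: ifPn => [Pij|nPij].
  have lein : (i < n.+1)%N by rewrite ltnS (leq_trans _ (Pn _ _ Pij))// leq_addr.
  have lejn : (j < n.+1)%N by rewrite ltnS (leq_trans _ (Pn _ _ Pij))// leq_addl.
  rewrite (bigD1 (Ordinal lein, Ordinal lejn))//= eqxx big1 ?addr0// => -[i' j'].
  move=> /andP[_]; rewrite !xpair_eqE/= => ne.
  by rewrite !(eq_sym _ (nat_of_ord _)) (negPf ne) mulr0.
rewrite big1 ?add0r// => -[i' j']/= Pij'; case: ifPn; last by rewrite mulr0.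
by rewrite xpair_eqE => /andP[/eqP ii' /eqP jj']; rewrite ii' jj' Pij' in nPij.
Qed.

Lemma sum_dF_theta_lin D n (P : nat -> nat -> bool) (G : nat -> nat -> R)
    k s F p w : (forall i j, P i j -> (i + j <= n)%N) -> lin_on D k s F -> D p ->
  \sum_(i < n.+1) \sum_(j < n.+1 | P i j) G i j * dF_theta i j F p w =
  k * \sum_(m <- s | P m.1.1 m.1.2) G m.1.1 m.1.2 * m.2 p.
Proof.
move=> Pn FE Dp; rewrite -(sum_coef _ _ _ Pn) mulr_sumr; apply: eq_bigr => i _.
by rewrite mulr_sumr; apply: eq_bigr => j _; rewrite (dF_theta_lin _ _ _ FE)// mulrCA.
Qed.

Lemma derive_lin D k s F p v w : open D -> lin_on D k s F -> D p ->
  List.Forall (fun m => derivable m.2 p v) s ->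
  'D_v (F^~ w) p = k * \sum_(m <- s) 'D_v m.2 p * w m.1.1 m.1.2.
Proof.
move=> oD FE Dp ds.
rewrite (eq_on_open_derive (g := fun q => k * lin s q w) oD)//; last first.
  by move=> q Dq; rewrite FE.
have -> : (fun q => k * lin s q w) = k *: (fun q => lin s q w) by [].
suff [dl lE] : derivable (fun q => lin s q w) p v /\
    'D_v (fun q => lin s q w) p = \sum_(m <- s) 'D_v m.2 p * w m.1.1 m.1.2.
  by rewrite deriveZ// lE.
elim: s ds {FE} => [_|[[i j] c] s IHs ds].
  rewrite big_nil (_ : (fun q => _) = cst 0).
    by split; [exact: derivable_cst | rewrite derive_cst].
  by apply/funext => q; rewrite /lin big_nil.
have [dc {}ds] : derivable c p v /\ List.Forall (fun m => derivable m.2 p v) s.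
  by inversion ds.
have [dl lE] := IHs ds.
have -> : (fun q => lin ((i, j, c) :: s) q w) =
    w i j *: c + (fun q => lin s q w).
  by apply/funext => q; rewrite /lin big_cons/= mulrC.
have dZ : derivable (w i j *: c) p v by exact: derivableZ.
split; first by apply: derivableD.
by rewrite deriveD// deriveZ// lE big_cons/= mulrC.
Qed.

(** Leibniz rule for each term: D_u (c w_ij) = c_u w_ij + c w_(i+1)j. *)
Definition lin_total_u s :=
  [seq (m.1, pd_u m.2) | m <- s] ++ [seq (m.1.1.+1, m.1.2, m.2) | m <- s].

Definition lin_total_v s :=
  [seq (m.1, pd_v m.2) | m <- s] ++ [seq (m.1.1, m.1.2.+1, m.2) | m <- s].

Lemma smooth_coefs_derivable D s p v : smooth_coefs D s -> D p ->
  List.Forall (fun m => derivable m.2 p v) s.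
Proof.
by move=> ss Dp; apply: List.Forall_impl ss => m /smooth_on_derivable; exact.
Qed.

Lemma smooth_coefs_total_u D s : smooth_coefs D s ->
  smooth_coefs D (lin_total_u s).
Proof.
move=> ss; apply/List.Forall_app; split; apply/List.Forall_map;
  apply: List.Forall_impl ss => // m; exact: smooth_on_derive.
Qed.

Lemma smooth_coefs_total_v D s : smooth_coefs D s ->
  smooth_coefs D (lin_total_v s).
Proof.
move=> ss; apply/List.Forall_app; split; apply/List.Forall_map;
  apply: List.Forall_impl ss => // m; exact: smooth_on_derive.
Qed.

Lemma sum_order_le n s (G : nat * nat * (R * R -> R) -> R) : order_le n s ->
  \sum_(m <- s | (m.1.1 + m.1.2 <= n)%N) G m = \sum_(m <- s) G m.
Proof.
move=> os; rewrite -[in RHS](all_filterP os) big_filter.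
by apply: eq_bigl => m; rewrite /= ?andbT.
Qed.

(** By [order_le n s], cutting the sum over jet coordinates at order [n] loses no term. *)
Lemma total_u_lin D n k s F : open D -> smooth_coefs D s -> order_le n s ->
  lin_on D k s F -> lin_on D k (lin_total_u s) (total_u n F).
Proof.
move=> oD ss os FE p w Dp.
rewrite /total_u /pd_u (derive_lin _ oD FE)//; last exact: smooth_coefs_derivable ss Dp.
rewrite (sum_dF_theta_lin (P := fun i j => (i + j <= n)%N)
  (fun i j => w i.+1 j) _ _ FE)//.
rewrite (sum_order_le _ os) /lin /lin_total_u big_cat !big_map/= mulrDr.
by congr (_ + _ * _); apply: eq_bigr => m _; rewrite mulrC.
Qed.

Lemma total_v_lin D n k s F : open D -> smooth_coefs D s -> order_le n s ->
  lin_on D k s F -> lin_on D k (lin_total_v s) (total_v n F).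
Proof.
move=> oD ss os FE p w Dp.
rewrite /total_v /pd_v (derive_lin _ oD FE)//; last exact: smooth_coefs_derivable ss Dp.
rewrite (sum_dF_theta_lin (P := fun i j => (i + j <= n)%N)
  (fun i j => w i j.+1) _ _ FE)//.
rewrite (sum_order_le _ os) /lin /lin_total_v big_cat !big_map/= mulrDr.
by congr (_ + _ * _); apply: eq_bigr => m _; rewrite mulrC.
Qed.

(** The first sum comes from differentiating the coefficients along the base, the second from the
    terms phi^J. Terms in theta itself are absent from the second because phi vanishes. *)
Lemma prolong_lin D n (X : vfield R) s F p w : open D -> lin_on D 1 s F ->
  D p -> (forall v, List.Forall (fun m => derivable m.2 p v) s) ->
  vphi X (p, w 0%N 0%N) = 0 ->
  prolong n X F p w =
  \sum_(m <- s) (vzeta X (p, w 0%N 0%N) * pd_u m.2 p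
    + veta X (p, w 0%N 0%N) * pd_v m.2 p) * w m.1.1 m.1.2
  + \sum_(m <- s | (1 <= m.1.1 + m.1.2 <= n)%N)
      phiJ n X m.1.1 m.1.2 p w * m.2 p.
Proof.
move=> oD FE Dp ds phi0; rewrite /prolong phi0 mul0r addr0; congr (_ + _).
  rewrite /pd_u /pd_v !(derive_lin _ oD FE)// !mul1r !mulr_sumr -big_split/=.
  by apply: eq_bigr => m _; ring.
rewrite (sum_dF_theta_lin (P := fun i j => (1 <= i + j <= n)%N)
  (fun i j => phiJ n X i j p w) _ _ FE)// ?mul1r//.
by move=> i j /andP[].
Qed.

End linear_differential_functions.

(* [ring] and [lra] compare atoms up to conversion, which is very slow on
   partial derivatives. *)
Ltac jet_atoms := repeat match goal with
  | |- context [pd_u ?f ?p] => generalize (pd_u f p); intro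
  | |- context [pd_v ?f ?p] => generalize (pd_v f p); intro
  | w : jet _ |- context [?w' ?i ?j] =>
      constr_eq w w'; generalize (w i j); intro
  end.

Ltac jet_ring := jet_atoms; ring.

(** * Prolongation of the three equations and the resulting conditions *)

Section prolongation.
Context {R : realType} {D : set (R * R)} {X : vfield R} {z e : R * R -> R}.
Hypotheses (oD : open D) (sz : smooth_on D z) (se : smooth_on D e).
Hypothesis XE : forall p th, D p ->
  [/\ vzeta X (p, th) = z p, veta X (p, th) = e p & vphi X (p, th) = 0].

Let cs := [:: ((1, 0), z); ((0, 1), e)]%N.

Let cE : lin_on D (-1) cs (characteristic X).
Proof.
move=> p w Dp; have [zE eE pE] := XE (w 0%N 0%N) Dp.
by rewrite /characteristic zE eE pE /lin /cs !big_cons big_nil/=; ring.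
Qed.

Let scs : smooth_coefs D cs.
Proof. by repeat constructor. Qed.


(** Here and in the next four lemmas, the terms of order |J| + 1 in the total derivative of the
    characteristic cancel against the terms that [phiJ] adds to it. *)
Lemma phiJ10 p w : D p ->
  phiJ 2 X 1 0 p w = - (pd_u z p * w 1%N 0%N + pd_u e p * w 0%N 1%N).
Proof.
move=> Dp; have [zE eE _] := XE (w 0%N 0%N) Dp.
rewrite /phiJ zE eE /total_J /= (total_u_lin oD scs _ cE)//.
rewrite /lin /lin_total_u /cs /= !big_cons big_nil/=; jet_ring.
Qed.

Lemma phiJ01 p w : D p ->
  phiJ 2 X 0 1 p w = - (pd_v z p * w 1%N 0%N + pd_v e p * w 0%N 1%N).
Proof.
move=> Dp; have [zE eE _] := XE (w 0%N 0%N) Dp.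
rewrite /phiJ zE eE /total_J /= (total_v_lin oD scs _ cE)//.
rewrite /lin /lin_total_v /cs /= !big_cons big_nil/=; jet_ring.
Qed.

Lemma phiJ20 p w : D p ->
  phiJ 2 X 2 0 p w =
  - (pd_u (pd_u z) p * w 1%N 0%N + 2 * pd_u z p * w 2%N 0%N
     + pd_u (pd_u e) p * w 0%N 1%N + 2 * pd_u e p * w 1%N 1%N).
Proof.
move=> Dp; have [zE eE _] := XE (w 0%N 0%N) Dp.
rewrite /phiJ zE eE /total_J /= (total_u_lin oD (smooth_coefs_total_u scs) _
  (total_u_lin (n := 2) oD scs _ cE))//.
rewrite /lin /lin_total_u /cs /= !big_cons big_nil/=; jet_ring.
Qed.

(** [total_J] applies [total_v] first, so mixed derivatives appear only as [pd_u (pd_v _)]. *)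
Lemma phiJ11 p w : D p ->
  phiJ 2 X 1 1 p w =
  - (pd_u (pd_v z) p * w 1%N 0%N + pd_v z p * w 2%N 0%N + pd_u z p * w 1%N 1%N
     + pd_u (pd_v e) p * w 0%N 1%N + pd_v e p * w 1%N 1%N
     + pd_u e p * w 0%N 2%N).
Proof.
move=> Dp; have [zE eE _] := XE (w 0%N 0%N) Dp.
rewrite /phiJ zE eE /total_J /= (total_u_lin oD (smooth_coefs_total_v scs) _
  (total_v_lin (n := 2) oD scs _ cE))//.
rewrite /lin /lin_total_u /lin_total_v /cs /= !big_cons big_nil/=; jet_ring.
Qed.

Lemma phiJ02 p w : D p ->
  phiJ 2 X 0 2 p w =
  - (pd_v (pd_v z) p * w 1%N 0%N + 2 * pd_v z p * w 1%N 1%N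
     + pd_v (pd_v e) p * w 0%N 1%N + 2 * pd_v e p * w 0%N 2%N).
Proof.
move=> Dp; have [zE eE _] := XE (w 0%N 0%N) Dp.
rewrite /phiJ zE eE /total_J /= (total_v_lin oD (smooth_coefs_total_v scs) _
  (total_v_lin (n := 2) oD scs _ cE))//.
rewrite /lin /lin_total_v /cs /= !big_cons big_nil/=; jet_ring.
Qed.

Variables a b h a2 b2 : R * R -> R.
Hypotheses (sa : smooth_on D a) (sb : smooth_on D b) (sh : smooth_on D h)
  (sa2 : smooth_on D a2) (sb2 : smooth_on D b2).

Let oppE (f : R * R -> R) p : (- f) p = - f p. Proof. by []. Qed.

Let pd_oppu f p : smooth_on D f -> D p -> pd_u (- f) p = - pd_u f p.
Proof. by move=> sf Dp; apply/deriveN/smooth_on_derivable/Dp. Qed.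

Let pd_oppv f p : smooth_on D f -> D p -> pd_v (- f) p = - pd_v f p.
Proof. by move=> sf Dp; apply/deriveN/smooth_on_derivable/Dp. Qed.

Let pd_cstu c p : pd_u (cst c) p = 0 :> R. Proof. exact: derive_cst. Qed.

Let pd_cstv c p : pd_v (cst c) p = 0 :> R. Proof. exact: derive_cst. Qed.

Let dopp f p v : smooth_on D f -> D p -> derivable (- f) p v.
Proof. by move=> sf Dp; apply/derivableN/smooth_on_derivable/Dp. Qed.

Lemma prolong_uu p w (k : 'I_3) : val k = 0%N -> D p ->
  prolong 2 X (theta_system a b h a2 b2 k) p w =
  - ((z p * pd_u a p + e p * pd_v a p) * w 1%N 0%N
     + (z p * pd_u b p + e p * pd_v b p) * w 0%N 1%N)
  - (pd_u (pd_u z) p * w 1%N 0%N + 2 * pd_u z p * w 2%N 0%N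
     + pd_u (pd_u e) p * w 0%N 1%N + 2 * pd_u e p * w 1%N 1%N)
  + a p * (pd_u z p * w 1%N 0%N + pd_u e p * w 0%N 1%N)
  + b p * (pd_v z p * w 1%N 0%N + pd_v e p * w 0%N 1%N).
Proof.
move=> k0 Dp; have [zE eE pE] := XE (w 0%N 0%N) Dp.
rewrite (prolong_lin (s := [:: (2%N, 0%N, cst 1); (1%N, 0%N, - a); (0%N, 1%N, - b)])
  2 oD _ Dp _ pE).
- rewrite !big_cons !big_nil/= !pd_oppu// !pd_oppv// !pd_cstu !pd_cstv zE eE.
  by rewrite phiJ20// phiJ10// phiJ01// ?oppE; jet_ring.
- move=> q w' _; rewrite /theta_system k0 /lin !big_cons !big_nil/= ?oppE; ring.
- by move=> v; repeat constructor => /=; [exact: derivable_cst|exact: dopp|exact: dopp].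
Qed.

Lemma prolong_uv p w (k : 'I_3) : val k = 1%N -> D p ->
  prolong 2 X (theta_system a b h a2 b2 k) p w =
  - ((z p * pd_u h p + e p * pd_v h p) * w 0%N 0%N)
  - (pd_u (pd_v z) p * w 1%N 0%N + pd_v z p * w 2%N 0%N + pd_u z p * w 1%N 1%N
     + pd_u (pd_v e) p * w 0%N 1%N + pd_v e p * w 1%N 1%N
     + pd_u e p * w 0%N 2%N).
Proof.
move=> k1 Dp; have [zE eE pE] := XE (w 0%N 0%N) Dp.
rewrite (prolong_lin (s := [:: (1%N, 1%N, cst 1); (0%N, 0%N, - h)])
  2 oD _ Dp _ pE).
- rewrite !big_cons !big_nil/= !pd_oppu// !pd_oppv// !pd_cstu !pd_cstv zE eE.
  by rewrite phiJ11// ?oppE; jet_ring.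
- move=> q w' _; rewrite /theta_system k1 /lin !big_cons !big_nil/= ?oppE; ring.
- by move=> v; repeat constructor => /=; [exact: derivable_cst|exact: dopp].
Qed.

Lemma prolong_vv p w (k : 'I_3) : val k = 2%N -> D p ->
  prolong 2 X (theta_system a b h a2 b2 k) p w =
  - ((z p * pd_u a2 p + e p * pd_v a2 p) * w 1%N 0%N
     + (z p * pd_u b2 p + e p * pd_v b2 p) * w 0%N 1%N)
  - (pd_v (pd_v z) p * w 1%N 0%N + 2 * pd_v z p * w 1%N 1%N
     + pd_v (pd_v e) p * w 0%N 1%N + 2 * pd_v e p * w 0%N 2%N)
  + a2 p * (pd_u z p * w 1%N 0%N + pd_u e p * w 0%N 1%N)
  + b2 p * (pd_v z p * w 1%N 0%N + pd_v e p * w 0%N 1%N).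
Proof.
move=> k2 Dp; have [zE eE pE] := XE (w 0%N 0%N) Dp.
rewrite (prolong_lin (s := [:: (0%N, 2%N, cst 1); (1%N, 0%N, - a2); (0%N, 1%N, - b2)])
  2 oD _ Dp _ pE).
- rewrite !big_cons !big_nil/= !pd_oppu// !pd_oppv// !pd_cstu !pd_cstv zE eE.
  by rewrite phiJ02// phiJ10// phiJ01// ?oppE; jet_ring.
- move=> q w' _; rewrite /theta_system k2 /lin !big_cons !big_nil/= ?oppE; ring.
- by move=> v; repeat constructor => /=; [exact: derivable_cst|exact: dopp|exact: dopp].
Qed.

(** The determining equations in partial derivatives, for use while [z] and [e] are still functions
    of both variables. *)
Definition symmetry_equations p :=
  [/\ z p * pd_u a p + e p * pd_v a p + a p * pd_u z p + pd_u (pd_u z) p = 0,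
      z p * pd_u b p + e p * pd_v b p - b p * pd_v e p + 2 * b p * pd_u z p = 0,
      z p * pd_u h p + e p * pd_v h p + h p * (pd_u z p + pd_v e p) = 0,
      z p * pd_u a2 p + e p * pd_v a2 p - a2 p * pd_u z p
        + 2 * a2 p * pd_v e p = 0 &
      z p * pd_u b2 p + e p * pd_v b2 p + b2 p * pd_v e p
        + pd_v (pd_v e) p = 0].

Lemma zero_on_derive (f : R * R -> R) p v : (forall q, D q -> f q = 0) ->
  D p -> 'D_v f p = 0.
Proof.
by move=> f0 Dp; rewrite (eq_on_open_derive (g := cst 0) oD)// derive_cst.
Qed.

Let symmetric := forall (nu : 'I_3) (p : R * R) (w : jet R), D p ->
  (forall mu, theta_system a b h a2 b2 mu p w = 0) ->
  prolong 2 X (theta_system a b h a2 b2 nu) p w = 0.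

Lemma symmetric_equations : (forall p, D p -> h p != 0) -> symmetric ->
  forall p, D p -> [/\ pd_v z p = 0, pd_u e p = 0 & symmetry_equations p].
Proof.
move=> h0 sym.
(* The solution jet over [p] with theta = x, theta_u = y, theta_v = t: the system fixes the
   second-order coordinates, and higher ones, which do not enter the formulas, are set to 0. *)
pose wsol p (x y t : R) : jet R := fun i j => match i, j with
  | 0%N, 0%N => x | 1%N, 0%N => y | 0%N, 1%N => t
  | 2%N, 0%N => a p * y + b p * t
  | 1%N, 1%N => h p * x
  | 0%N, 2%N => a2 p * y + b2 p * t
  | _, _ => 0
  end.
have sol p x y t mu : theta_system a b h a2 b2 mu p (wsol p x y t) = 0.
  by case: mu => [[|[|[|//]]] ?]; rewrite /theta_system/= subrr.
(* Each prolongation formula, evaluated at this jet, equals 0; its long left-hand side is inferred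
   from the proof term. *)
have Euu p x y t : D p -> _ := fun Dp =>
  etrans (esym (prolong_uu (wsol p x y t) (erefl : val (@Ordinal 3 0 isT) = 0%N) Dp))
         (sym _ _ _ Dp (sol _ _ _ _)).
have Euv p x y t : D p -> _ := fun Dp =>
  etrans (esym (prolong_uv (wsol p x y t) (erefl : val (@Ordinal 3 1 isT) = 1%N) Dp))
         (sym _ _ _ Dp (sol _ _ _ _)).
have Evv p x y t : D p -> _ := fun Dp =>
  etrans (esym (prolong_vv (wsol p x y t) (erefl : val (@Ordinal 3 2 isT) = 2%N) Dp))
         (sym _ _ _ Dp (sol _ _ _ _)).
rewrite /= in Euu Euv Evv.
have eu p : D p -> pd_u e p = 0.
  move=> Dp; apply: (mulIf (h0 _ Dp)); have := Euu p 1 0 0 Dp; jet_atoms; lra.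
have zv p : D p -> pd_v z p = 0.
  move=> Dp; apply: (mulIf (h0 _ Dp)); have := Evv p 1 0 0 Dp; jet_atoms; lra.
move=> p Dp; split; [exact: zv | exact: eu|].
have euu : pd_u (pd_u e) p = 0 by exact: zero_on_derive.
have zvv : pd_v (pd_v z) p = 0 by exact: zero_on_derive.
(* Unit jets extract the coefficients of theta_u and theta_v in the first and third conditions, and
   of theta in the second. *)
have := (Euu p 0 1 0 Dp, Euu p 0 0 1 Dp, Euv p 1 0 0 Dp, Evv p 0 1 0 Dp,
  Evv p 0 0 1 Dp).
rewrite /symmetry_equations eu// zv// euu zvv; jet_atoms => -[[[[E1 E2] E3] E4] E5].
by split; lra.
Qed.

(** Deducing [pd_u (pd_v e) p = 0] from the vanishing of [pd_u e] would require interchanging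
    partial derivatives. It is a separate hypothesis, immediate once [e] depends on v alone. *)
Lemma equations_symmetric :
  (forall p, D p -> [/\ pd_v z p = 0, pd_u e p = 0, pd_u (pd_v e) p = 0 &
     symmetry_equations p]) -> symmetric.
Proof.
move=> eqs nu p w Dp sol.
have [zv eu euv [E1 E2 E3 E4 E5]] := eqs _ Dp.
have euu : pd_u (pd_u e) p = 0 by apply: zero_on_derive => // q /eqs[].
have zuv : pd_u (pd_v z) p = 0 by apply: zero_on_derive => // q /eqs[].
have zvv : pd_v (pd_v z) p = 0 by apply: zero_on_derive => // q /eqs[].
(* The system eliminates the second-order coordinates; each prolongation is then minus a combination
   of the determining equations with coefficients theta, theta_u or theta_v. *)
have /subr0_eq w20 := sol (@Ordinal 3 0 isT).
have /subr0_eq w11 := sol (@Ordinal 3 1 isT).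
have /subr0_eq w02 := sol (@Ordinal 3 2 isT).
rewrite /= in w20 w11 w02.
case: nu => -[|[|[|//]]] lt3.
- rewrite prolong_uu// zv eu euu w20 w11.
  transitivity (- (w 1%N 0%N * (z p * pd_u a p + e p * pd_v a p + a p * pd_u z p
    + pd_u (pd_u z) p) + w 0%N 1%N * (z p * pd_u b p + e p * pd_v b p
    - b p * pd_v e p + 2 * b p * pd_u z p))); first by jet_ring.
  by rewrite E1 E2 !mulr0 addr0 oppr0.
- rewrite prolong_uv// zv eu zuv euv w20 w11 w02.
  transitivity (- (w 0%N 0%N * (z p * pd_u h p + e p * pd_v h p
    + h p * (pd_u z p + pd_v e p)))); first by jet_ring.
  by rewrite E3 mulr0 oppr0.
- rewrite prolong_vv// zv eu zvv w02 w11.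
  transitivity (- (w 1%N 0%N * (z p * pd_u a2 p + e p * pd_v a2 p
    - a2 p * pd_u z p + 2 * a2 p * pd_v e p) + w 0%N 1%N * (z p * pd_u b2 p
    + e p * pd_v b2 p + b2 p * pd_v e p + pd_v (pd_v e) p))); first by jet_ring.
  by rewrite E4 E5 !mulr0 addr0 oppr0.
Qed.

End prolongation.

(** * Functions of one coordinate on a plane open set *)

Section coordinates.
Context {R : realType}.
Implicit Types (D U : set (R * R)) (f : R * R -> R) (g : R -> R) (p : R * R).

Lemma derive_dir0 (V W : normedModType R) (f : V -> W) x : 'D_0 f x = 0.
Proof.
rewrite /derive (_ : (fun _ => _) = cst 0); first exact: lim_cst.
by apply/funext => t /=; rewrite scaler0 add0r subrr scaler0.
Qed.

Lemma Ck_on_cst (V : normedModType R) k (U : set V) (c : R) :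
  Ck_on k U (cst c : V -> R).
Proof.
elim: k c => [|k IHk] c; split => //;
  try by move=> x _; exact: cst_continuous.
move=> v; split=> [x _|]; first exact: derivable_cst.
rewrite (_ : 'D_v _ = cst 0)//; apply/funext => x; exact: derive_cst.
Qed.

(** The first projection sends (1, 0) to 1 and (0, 1) to 0, and a derivative along 0 vanishes. *)
Lemma pd_fst_comp D f g : open D -> (forall p, D p -> f p = g p.1) ->
  forall p, D p -> pd_u f p = derive1 g p.1 /\ pd_v f p = 0.
Proof.
move=> oD fg p Dp; rewrite derive1E /pd_u /pd_v.
have fstE (x v : R * R) (t : R) : (t *: v + x).1 = t *: v.1 + x.1 by [].
by rewrite !(derive_affine fstE oD _ fg Dp)/= derive_dir0.
Qed.

Lemma pd_snd_comp D f g : open D -> (forall p, D p -> f p = g p.2) ->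
  forall p, D p -> pd_v f p = derive1 g p.2 /\ pd_u f p = 0.
Proof.
move=> oD fg p Dp; rewrite derive1E /pd_u /pd_v.
have sndE (x v : R * R) (t : R) : (t *: v + x).2 = t *: v.2 + x.2 by [].
by rewrite !(derive_affine sndE oD _ fg Dp)/= derive_dir0.
Qed.

Lemma continuous_pairl (V W : normedModType R) (y : W) :
  continuous (fun x : V => (x, y)).
Proof. by move=> x; apply: cvg_pair; [exact: cvg_id | exact: cvg_cst]. Qed.

Lemma continuous_pairr (V W : normedModType R) (x : V) :
  continuous (fun y : W => (x, y)).
Proof. by move=> y; apply: cvg_pair; [exact: cvg_cst | exact: cvg_id]. Qed.

Lemma pairl_affine (V W : normedModType R) (y : W) (x v : V) (t : R) :
  (t *: v + x, y) = t *: (v, 0) + (x, y).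
Proof. by congr pair; rewrite /= scaler0 add0r. Qed.

Lemma pairr_affine (V W : normedModType R) (x : V) (y v : W) (t : R) :
  (x, t *: v + y) = t *: (0, v) + (x, y).
Proof. by congr pair; rewrite /= scaler0 add0r. Qed.

Lemma open_vsection D u : open D -> open [set v | D (u, v)].
Proof. by move=> oD; apply: open_comp oD => v _; exact: continuous_pairr. Qed.

Lemma open_hsection D v : open D -> open [set u | D (u, v)].
Proof. by move=> oD; apply: open_comp oD => u _; exact: continuous_pairl. Qed.

(** On each vertical section, an interval, [f] is constant by the mean value theorem. *)
Lemma pd_v_eq0_fst D f : open D ->
  (forall u, is_interval [set v | D (u, v)]) -> smooth_on D f ->
  (forall p, D p -> pd_v f p = 0) ->
  exists2 g, smooth_on (fst @` D) g & forall p, D p -> f p = g p.1.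
Proof.
move=> oD itvD sf f0.
have fcst u v v' : D (u, v) -> D (u, v') -> f (u, v) = f (u, v').
  apply: (zero_derive_interval_cst (f := fun x => f (u, x)) (itvD u)) => x Dux.
  have fE y : [set v | D (u, v)] y -> f (u, y) = f (u, y) by [].
  have oDu : open [set v | D (u, v)] := open_vsection oD.
  apply: DeriveDef.
    apply: (derivable_affine (pairr_affine u) oDu fE Dux).
    exact: smooth_on_derivable sf Dux.
  by rewrite (derive_affine (pairr_affine u) oDu _ fE Dux) -[RHS](f0 _ Dux).
(* The value of [f] at some chosen point of the section over [u]; the default 0 serves only for
   empty sections, outside the projection of [D]. *)
pose g u := f (u, xget 0 [set v | D (u, v)]).
have fg u v : D (u, v) -> f (u, v) = g u.
  by move=> Duv; apply: fcst => //; exact: (xgetPex 0 (ex_intro (fun v => D (u, v)) v Duv)).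
exists g => [k|[u v]]; last exact: fg.
(* The chosen point may vary irregularly with [u], but around [u] the function [g] is also the
   restriction of [f] to the horizontal line at height [v], hence smooth. *)
apply: Ck_on_local => _ [[u v] Duv <-]; exists [set x | D (x, v)] => //.
have gE x : [set x | D (x, v)] x -> g x = f (x, v) by move=> /fg.
have cv : continuous (fun x : R => (x, v)) by exact: continuous_pairl.
by have := Ck_on_affine cv (pairl_affine v) (open_hsection oD) _ gE (sf k); exact.
Qed.

Lemma pd_u_eq0_snd D f : open D ->
  (forall v, is_interval [set u | D (u, v)]) -> smooth_on D f ->
  (forall p, D p -> pd_u f p = 0) ->
  exists2 g, smooth_on (snd @` D) g & forall p, D p -> f p = g p.2.
Proof.
move=> oD itvD sf f0.
have fcst v u u' : D (u, v) -> D (u', v) -> f (u, v) = f (u', v).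
  apply: (zero_derive_interval_cst (f := fun x => f (x, v)) (itvD v)) => x Dxv.
  have fE y : [set u | D (u, v)] y -> f (y, v) = f (y, v) by [].
  have oDv : open [set u | D (u, v)] := open_hsection oD.
  apply: DeriveDef.
    apply: (derivable_affine (pairl_affine v) oDv fE Dxv).
    exact: smooth_on_derivable sf Dxv.
  by rewrite (derive_affine (pairl_affine v) oDv _ fE Dxv) -[RHS](f0 _ Dxv).
pose g v := f (xget 0 [set u | D (u, v)], v).
have fg u v : D (u, v) -> f (u, v) = g v.
  by move=> Duv; apply: fcst => //; exact: (xgetPex 0 (ex_intro (fun u => D (u, v)) u Duv)).
exists g => [k|[u v]]; last exact: fg.
apply: Ck_on_local => _ [[u v] Duv <-]; exists [set y | D (u, y)] => //.
have gE y : [set y | D (u, y)] y -> g y = f (u, y) by move=> /fg.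
have cu : continuous (fun y : R => (u, y)) by exact: continuous_pairr.
by have := Ck_on_affine cu (pairr_affine u) (open_vsection oD) _ gE (sf k); exact.
Qed.

(** A ball of the product norm is a product of two intervals. *)
Lemma open_box D p : open D -> D p -> exists U, [/\ open U, U p, U `<=` D,
  forall u, is_interval [set v | U (u, v)] &
  forall v, is_interval [set u | U (u, v)]].
Proof.
move=> oD Dp; have [r r0 prD] := (nbhs_ballP _ _).1 (open_nbhs_nbhs (conj oD Dp)).
have itv_ball (x : R) : is_interval (ball x r).
  move=> y y' By By' t /andP[yt ty']; move: By By'.
  rewrite !ball_itv/= !in_itv/= => /andP[xy _] /andP[_ xy'].
  by rewrite (lt_le_trans xy yt) (le_lt_trans ty' xy').
exists (ball p r); split => //; first exact: ball_open.
- exact: ballxx.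
- by move=> u v v' [pu pv] [_ pv'] t vt; split => //; apply: itv_ball pv pv' _ vt.
- by move=> v u u' [pu pv] [pu' _] t ut; split => //; apply: itv_ball pu pu' _ ut.
Qed.

End coordinates.

(** * Equivalence of the symmetry condition and the general form *)

Section symmetries_of_the_base.
Context {R : realType}.
Implicit Types (D U : set (R * R)) (X : vfield R).

Lemma Ck_on_subset (V : normedModType R) k (U U' : set V) (f : V -> R) :
  U' `<=` U -> Ck_on k U f -> Ck_on k U' f.
Proof. by move=> U'U Cf; apply: Ck_on_local => x /U'U Ux; exists U. Qed.

Lemma smooth_on_subset (V : normedModType R) (U U' : set V) (f : V -> R) :
  U' `<=` U -> smooth_on U f -> smooth_on U' f.
Proof. by move=> U'U sf k; exact: Ck_on_subset (sf k). Qed.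

Lemma open_cylinder D : open D -> open (D `*` [set: R]).
Proof.
move=> oD; rewrite (_ : D `*` _ = fst @^-1` D).
  by apply: open_comp oD => x _; exact: cvg_fst.
by apply/seteqP; split => [x []|x].
Qed.

Lemma smooth_on_base D (F : R * R * R -> R) : open D ->
  smooth_on (D `*` [set: R]) F -> smooth_on D (fun p => F (p, 0)).
Proof.
move=> oD sF k.
have c0 : continuous (fun p : R * R => (p, 0 : R)) by exact: continuous_pairl.
by have := Ck_on_affine c0 (pairl_affine (0 : R)) oD _ (fun _ _ => erefl) (sF k);
  apply => p Dp.
Qed.

Lemma smooth_on_cylinder_fst D (F : R * R * R -> R) (g : R -> R) : open D ->
  smooth_on (fst @` D) g -> (forall p th, D p -> F (p, th) = g p.1) ->
  smooth_on (D `*` [set: R]) F.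
Proof.
move=> oD sg FE k.
have cA : continuous (fun m : R * R * R => m.1.1).
  by move=> m; apply: (cvg_comp fst fst); exact: cvg_fst.
have AL (x v : R * R * R) (t : R) : (t *: v + x).1.1 = t *: v.1.1 + x.1.1 by [].
have FgE y : (D `*` [set: R]) y -> F y = g y.1.1.
  by case: y => p th [Dp _]; exact: FE.
have := Ck_on_affine cA AL (open_cylinder oD) _ FgE (sg k).
by apply => -[p th] [Dp _]; exists p.
Qed.

Lemma smooth_on_cylinder_snd D (F : R * R * R -> R) (g : R -> R) : open D ->
  smooth_on (snd @` D) g -> (forall p th, D p -> F (p, th) = g p.2) ->
  smooth_on (D `*` [set: R]) F.
Proof.
move=> oD sg FE k.
have cA : continuous (fun m : R * R * R => m.1.2).
  by move=> m; apply: (cvg_comp fst snd); [exact: cvg_fst | exact: cvg_snd].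
have AL (x v : R * R * R) (t : R) : (t *: v + x).1.2 = t *: v.1.2 + x.1.2 by [].
have FgE y : (D `*` [set: R]) y -> F y = g y.1.2.
  by case: y => p th [Dp _]; exact: FE.
have := Ck_on_affine cA AL (open_cylinder oD) _ FgE (sg k).
by apply => -[p th] [Dp _]; exists p.
Qed.

Variables a b h a2 b2 : R * R -> R.

Lemma G2_algebra_subset D U X : U `<=` D ->
  G2_algebra D a b h a2 b2 X -> G2_algebra U a b h a2 b2 X.
Proof.
move=> UD [[sz se sp sym] [zeta [eta XE]]].
have UDT : U `*` [set: R] `<=` D `*` [set: R] by move=> m [/UD].
split; first split; try exact: smooth_on_subset UDT _.
  by move=> nu p w /UD; exact: sym.
by exists zeta, eta => p th /UD; exact: XE.
Qed.

Lemma G2_algebra_local D X :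
  (forall p, D p -> exists U, [/\ U p & G2_algebra U a b h a2 b2 X]) ->
  G2_algebra D a b h a2 b2 X.
Proof.
move=> loc; split; first split.
- move=> k; apply: Ck_on_local => -[p th] [/loc[U [Up [[sz _ _ _] _]]] _].
  by exists (U `*` [set: R]).
- move=> k; apply: Ck_on_local => -[p th] [/loc[U [Up [[_ se _ _] _]]] _].
  by exists (U `*` [set: R]).
- move=> k; apply: Ck_on_local => -[p th] [/loc[U [Up [[_ _ sp _] _]]] _].
  by exists (U `*` [set: R]).
- by move=> nu p w /loc[U [Up [[_ _ _ sym] _]]]; exact: sym.
(* The local witnesses depend on [U]; evaluation at theta = 0 gives one pair of coefficients for all
   of [D]. *)
exists (fun p => vzeta X (p, 0)), (fun p => veta X (p, 0)) => p th.
move=> /loc[U [Up [_ [zeta [eta XE]]]]].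
have [-> -> _] := XE p 0 Up.
exact: XE.
Qed.

Lemma general_form_G2 D X : open D -> smooth_on D a -> smooth_on D b ->
  smooth_on D h -> smooth_on D a2 -> smooth_on D b2 ->
  general_form D a b h a2 b2 X -> G2_algebra D a b h a2 b2 X.
Proof.
move=> oD sa sb sh sa2 sb2 [zeta [eta [szeta seta XE deteq]]].
pose z p := vzeta X (p, 0); pose e p := veta X (p, 0).
have zE p : D p -> z p = zeta p.1 by move=> Dp; have [] := XE p 0 Dp.
have eE p : D p -> e p = eta p.2 by move=> Dp; have [] := XE p 0 Dp.
have XzE p th : D p ->
    [/\ vzeta X (p, th) = z p, veta X (p, th) = e p & vphi X (p, th) = 0].
  by move=> Dp; rewrite zE// eE//; exact: XE.
have zsm : smooth_on (D `*` [set: R]) (vzeta X).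
  by apply: smooth_on_cylinder_fst szeta _ => // p th /(XE p th)[].
have esm : smooth_on (D `*` [set: R]) (veta X).
  by apply: smooth_on_cylinder_snd seta _ => // p th /(XE p th)[].
split; last by exists z, e.
split => //.
  apply: (@smooth_on_cylinder_fst D _ (cst 0)) => //.
    by move=> k; exact: Ck_on_cst.
  by move=> p th /(XE p th)[].
apply: (equations_symmetric (z := z) (e := e) oD (smooth_on_base oD zsm)
  (smooth_on_base oD esm) XzE) => // p Dp.
have pdz := pd_fst_comp oD zE; have pde := pd_snd_comp oD eE.
(* [pd_u z] depends on u alone and [pd_v e] on v alone, so the same lemmas yield the second
   derivatives and, for [e], the vanishing mixed derivative. *)
have pdzz := pd_fst_comp oD (fun p Dp => (pdz p Dp).1).
have pdee := pd_snd_comp oD (fun p Dp => (pde p Dp).1).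
have [zu zv] := pdz p Dp; have [ev eu] := pde p Dp.
have [zuu _] := pdzz p Dp; have [evv euv] := pdee p Dp.
split; [exact: zv | exact: eu | exact: euv |].
rewrite /symmetry_equations zuu evv zu ev (zE p Dp) (eE p Dp).
exact: deteq.
Qed.

(** The symmetry condition gives z_v = e_u = 0; the interval sections then make [z] a function of u
    and [e] a function of v on all of [D]. *)
Lemma G2_general_form D X : open D -> smooth_on D a -> smooth_on D b ->
  smooth_on D h -> smooth_on D a2 -> smooth_on D b2 ->
  (forall p, D p -> h p != 0) ->
  (forall u, is_interval [set v | D (u, v)]) ->
  (forall v, is_interval [set u | D (u, v)]) ->
  G2_algebra D a b h a2 b2 X -> general_form D a b h a2 b2 X.
Proof.
move=> oD sa sb sh sa2 sb2 h0 itvv itvu [[sz se _ sym] [zeta0 [eta0 XE]]].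
pose z p := vzeta X (p, 0); pose e p := veta X (p, 0).
have XzE p th : D p ->
    [/\ vzeta X (p, th) = z p, veta X (p, th) = e p & vphi X (p, th) = 0].
  move=> Dp; have [zE eE _] := XE p 0 Dp.
  by rewrite /z /e zE eE; exact: XE.
have zsm : smooth_on D z := smooth_on_base oD sz.
have esm : smooth_on D e := smooth_on_base oD se.
have eqs := symmetric_equations oD zsm esm XzE sa sb sh sa2 sb2 h0 sym.
have [zeta szeta zE] : exists2 g, smooth_on (fst @` D) g &
    forall p, D p -> z p = g p.1.
  by apply: pd_v_eq0_fst => // p /eqs[].
have [eta seta eE] : exists2 g, smooth_on (snd @` D) g &
    forall p, D p -> e p = g p.2.
  by apply: pd_u_eq0_snd => // p /eqs[].
exists zeta, eta; split => // [p th Dp|p Dp].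
  by have [-> -> ->] := XzE p th Dp; rewrite zE// eE.
have pdz := pd_fst_comp oD zE; have pde := pd_snd_comp oD eE.
have pdzz := pd_fst_comp oD (fun p Dp => (pdz p Dp).1).
have pdee := pd_snd_comp oD (fun p Dp => (pde p Dp).1).
have [zu _] := pdz p Dp; have [ev _] := pde p Dp.
have [zuu _] := pdzz p Dp; have [evv _] := pdee p Dp.
have [_ _] := eqs p Dp.
by rewrite /symmetry_equations zuu evv zu ev (zE p Dp) (eE p Dp); exact.
Qed.

End symmetries_of_the_base.

Unset Implicit Arguments.

(* A function with vanishing v-derivative on an arbitrary open D is only locally
   a function of u alone, whence the first equivalence; when the sections of D
   parallel to the axes are intervals, the second one gives zeta(u) and eta(v)
   on the whole of D. *)
Theorem theorem7 (R : realType) (D : set (R * R)) (a b h a2 b2 : R * R -> R)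
    (openD : open D)
    (smooth_a : smooth_on D a) (smooth_b : smooth_on D b)
    (smooth_h : smooth_on D h)
    (smooth_a2 : smooth_on D a2) (smooth_b2 : smooth_on D b2)
    (h_neq0 : forall p, D p -> h p != 0)
    (integr : integrability D a b h a2 b2) :
  (forall X : vfield R,
     G2_algebra D a b h a2 b2 X <->
     forall p, D p -> exists U : set (R * R),
       [/\ open U, U p, U `<=` D & general_form U a b h a2 b2 X])
  /\
  ((forall u, is_interval [set v | D (u, v)]) ->
   (forall v, is_interval [set u | D (u, v)]) ->
   forall X : vfield R,
     G2_algebra D a b h a2 b2 X <-> general_form D a b h a2 b2 X).
Proof.
split=> [X|itvv itvu X]; last first.
  by split; [exact: G2_general_form | exact: general_form_G2].
split=> [GX p Dp|loc].
  (* In a box around [p] the sections are intervals, so the global form is available there. *)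
  have [U [oU Up UD itvv itvu]] := open_box openD Dp.
  exists U; split => //; apply: G2_general_form => //;
    try exact: (smooth_on_subset UD).
    by move=> q /UD; exact: h_neq0.
  exact: G2_algebra_subset GX.
(* Conversely, the symmetry condition is checked point by point, each point inside its own [U], even
   though [zeta] and [eta] may change with [U]. *)
apply: G2_algebra_local => p /loc[U [oU Up UD gU]].
exists U; split => //; apply: general_form_G2 gU => //;
  exact: (smooth_on_subset UD).
Qed.
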